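(* Let $p$ be an odd prime, $m$ a positive integer, $q=p^m$, and let $u$ be a positive integer. Let $\mathrm{Tr}$ denote the trace map from $\mathbb{F}_q$ to $\mathbb{F}_p$. Let \[ D_1=\{(x,y)\in\mathbb{F}_q^2\setminus\{(0,0)\} : \mathrm{Tr}(x+y^{p^u+1})=0\}, \] and let $C_{D_1}=\{c(a,b)=(\mathrm{Tr}(ax+by))_{(x,y)\in D_1} : a,b\in\mathbb{F}_q\}$ (the coordinates indexed by the elements of $D_1$ in some fixed order). If $m$ is odd, then $C_{D_1}$ is a $[p^{2m-1}-1,2m]$ three-weight linear code over $\mathbb{F}_p$ whose weight distribution is: weight $0$ with multiplicity $1$; weight $(p-1)p^{2m-2}$ with multiplicity $p^{2m}-1-(p-1)^2p^{m-1}$; weight $(p-1)p^{2m-2}\left(1-\frac{1}{(p-1)p^{\frac{m-1}{2}}}\right)$ with multiplicity $\frac12(p-1)^2\left(p^{m-1}+p^{\frac{m-1}{2}}\right)$; and weight $(p-1)p^{2m-2}\left(1+\frac{1}{(p-1)p^{\frac{m-1}{2}}}\right)$ with multiplicity $\frac12(p-1)^2\left(p^{m-1}-p^{\frac{m-1}{2}}\right)$.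
   Context: An $[n,k]$ linear code over $\mathbb{F}_p$ is a $k$-dimensional subspace of $\mathbb{F}_p^n$. The multiplicity of a weight $w$ is the number $A_w$ of codewords of Hamming weight $w$; a code is $t$-weight if exactly $t$ nonzero weights occur.
   Formalization: The words ''three-weight'' are not asserted separately: for m = 1 the last multiplicity is 0, so only two nonzero weights occur; for odd m ≥ 3 the proved weight distribution, with all multiplicities positive, gives exactly three nonzero weights. *)

(* Defs.v *)
From HB Require Import structures.
From mathcomp Require Import all_boot all_order all_algebra.
Unset Strict Implicit. Unset Printing Implicit Defensive.
Import Order.TTheory GRing.Theory Num.Theory.
Local Open Scope ring_scope.

(* Absolute trace F_q -> F_p for q = p^m, written inside F:
   Tr(x) = x + x^p + ... + x^(p^(m-1)).  Its values lie in the prime field. *)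
Definition trace (F : finFieldType) (p m : nat) (x : F) : F :=
  \sum_(i < m) x ^+ (p ^ i).

Definition D1 (F : finFieldType) (p m u : nat) : {set F * F} :=
  [set z : F * F | (z != (0, 0)) && (trace F p m (z.1 + z.2 ^+ (p ^ u + 1)) == 0)].

Definition codeword (F : finFieldType) (p m u : nat) (a b : F)
  : #|D1 F p m u|.-tuple F :=
  [tuple trace F p m (a * (enum_val i).1 + b * (enum_val i).2) | i < #|D1 F p m u|].

Definition code (F : finFieldType) (p m u : nat) : {set #|D1 F p m u|.-tuple F} :=
  [set codeword F p m u ab.1 ab.2 | ab in [set: F * F]].

Definition wt {F : finFieldType} {n : nat} (c : n.-tuple F) : nat :=
  count (fun x => x != 0) c.

(* Main.v *)
Require Import Defs.
From HB Require Import structures.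
From mathcomp Require Import all_boot all_order all_algebra.
From mathcomp Require Import finfield zify ring.
Import Order.TTheory GRing.Theory Num.Theory.
Local Open Scope ring_scope.

(* The coordinates of [codeword a b] vanish on the part of the hypersurface
   [Tr x = - Q y], with [Q y = Tr (y^(p^u+1))], cut out by [Tr (a x + b y) = 0].
   If [a] is not in the prime field, or [a = 0 <> b], a permutation of the
   hypersurface shifts the coordinate by a nonzero constant, so all values occur
   equally often.  If [a] is a nonzero element of the prime field, completing the
   square with respect to the nondegenerate form polarising [Q] turns the number of
   zeros into [p^(m-1)] times the number [N c] of solutions of [Q y = c], where
   [c = Q z] and [b] corresponds to [z].
   No diagonalisation or Gauss sums are needed to find [N]: it is constant on
   nonzero squares and on nonsquares, [N c] is even for [c <> 0], and the sums of
   [N] and of [N^2] are known (the latter because [Q y = Q z] becomes bilinear in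
   [y + z, y - z]).  These constraints amount to [p S^2 + T^2 = p^(2k)] in integers,
   with [m = 2k+1], which infinite descent solves. *)

(** * Counting finite sets by fibres *)

Lemma card_fibers (T I : finType) (A : {set T}) (f : T -> I) :
  #|A| = (\sum_c #|[set x in A | f x == c]|)%N.
Proof.
rewrite -sum1_card (partition_big f xpredT) //=.
by apply: eq_bigr => c _; rewrite -sum1_card; apply: eq_bigl => x; rewrite inE.
Qed.

Lemma card_fibers_in (T I : finType) (A : {set T}) (f : T -> I) (B : {set I}) :
  {in A, forall x, f x \in B} ->
  #|A| = (\sum_(c in B) #|[set x in A | f x == c]|)%N.
Proof.
move=> fB; rewrite (card_fibers _ _ A f) [RHS]big_mkcond /=.
apply: eq_bigr => c _; case: ifP => // cB; apply: eq_card0 => x.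
by rewrite !inE; apply/negP=> /andP[/fB xB /eqP fx]; rewrite -fx xB in cB.
Qed.

(** Squaring identifies exactly [y] with [- y], and these differ because [2 y <> 0]. The lemma
    serves twice: for the evenness of the value counts and for the number of squares in the prime
    field. *)
Lemma card_sqr_symmetric (F : finFieldType) (A : {set F}) :
  2%:R != 0 :> F -> 0 \notin A -> {in A, forall y, - y \in A} ->
  #|A| = (2 * #|[set y ^+ 2 | y in A]|)%N.
Proof.
move=> two_neq0 A0 AN.
rewrite (card_fibers_in _ _ A (fun y => y ^+ 2) [set y ^+ 2 | y in A]); last first.
  by move=> y yA; apply: imset_f.
rewrite mulnC -sum_nat_const; apply: eq_bigr => _ /imsetP[y yA ->].
rewrite -[RHS](_ : #|[set y; - y]| = 2%N); last first.
  rewrite cards2 -subr_eq0 opprK -mulr2n -mulr_natr mulf_eq0 negb_or two_neq0 andbT.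
  by case: eqP yA A0 => // -> ->.
apply: eq_card => x; rewrite !inE eqf_sqr.
case: (eqVneq x y) => [->|_]; first by rewrite yA.
by case: eqVneq => [->|_]; rewrite ?AN ?andbF.
Qed.

(** * The integer equation behind the value counts *)

Lemma pell_prime (p k : nat) (S T : int) : prime p ->
  p%:Z * S ^+ 2 + T ^+ 2 = p%:Z ^+ (2 * k) ->
  S = 0 /\ (T = p%:Z ^+ k \/ T = - p%:Z ^+ k).
Proof.
move=> pr_p; have p_gt1 := prime_gt1 pr_p.
have dvd_sqr (x : int) : (p %| x ^+ 2)%Z -> exists y, x = p%:Z * y.
  rewrite dvdzE abszX absz_nat Euclid_dvdX // andbT => px.
  have /dvdzP[y ->] : (p %| x)%Z by rewrite dvdzE.
  by exists y; rewrite mulrC.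
elim: k S T => [|k IHk] S T.
  rewrite muln0 !expr0 => eqST.
  have S0 : S = 0.
    apply/eqP; apply: contraTT isT => S_neq0.
    have : 0 < S ^+ 2 by rewrite exprn_even_gt0.
    by have : 0 <= T ^+ 2 by [apply: sqr_ge0]; nia.
  split=> //; move/eqP: eqST; rewrite S0 expr0n mulr0 add0r -[X in _ == X](expr1n _ 2) eqf_sqr.
  by case/orP=> /eqP; [left | right].
move=> eqST.
(* The equation forces [p] to divide [T ^+ 2], hence [T]. After division by [p] the two squares swap
   roles, so [p] divides [S] as well, and a second division restores the equation with [k] lowered
   by one. *)
have [T' defT] : exists y, T = p%:Z * y.
  apply: dvd_sqr; apply/dvdzP; exists (p%:Z ^+ (2 * k).+1 - S ^+ 2).
  apply: (addrI (p%:Z * S ^+ 2)); by rewrite eqST [(2 * k.+1)%N]mulnS !exprS; ring.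
have p_neq0 : p%:Z != 0 by lia.
have eqST' : S ^+ 2 + p%:Z * T' ^+ 2 = p%:Z * p%:Z ^+ (2 * k).
  apply: (mulfI p_neq0); rewrite mulrDr; move: eqST; rewrite defT [(2 * k.+1)%N]mulnS exprD => eqp.
  by rewrite [RHS]mulrA -expr2 -eqp; ring.
have [S' defS] : exists y, S = p%:Z * y.
  apply: dvd_sqr; apply/dvdzP; exists (p%:Z ^+ (2 * k) - T' ^+ 2).
  by rewrite mulrC mulrBr -eqST' addrK.
have [|S'0 T'E] := IHk S' T'.
  apply: (mulfI p_neq0); rewrite -eqST' defS; ring.
by rewrite defT defS S'0 mulr0; split=> //; case: T'E => ->; rewrite exprS; [left|right; rewrite mulrN].
Qed.

(** Here [n0], [2 * a] and [2 * b] stand for the counts at zero, at a nonzero square and at a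
    nonsquare, with [h] values in each of the last two classes. The first moment eliminates [n0];
    the second, divided by [p], then becomes [2 * h] times the equation in the centred variables [S]
    and [T]. *)
Lemma value_counts_pell (p h K n0 a b : nat)
    (S := a%:Z + b%:Z - (K * K)%N%:Z) (T := a%:Z - b%:Z) :
  p = (2 * h).+1 -> (0 < h)%N -> (0 < K)%N ->
  (n0 + h * (2 * a + 2 * b) = p * (K * K))%N ->
  (p * (n0 ^ 2 + h * ((2 * a) ^ 2 + (2 * b) ^ 2)) =
    p * (p * (K * K)) + (p * (K * K)).-1 * (p * (K * K)))%N ->
  n0%:Z = (K * K)%N%:Z - 2 * h%:Z * S /\ p%:Z * S ^+ 2 + T ^+ 2 = (K * K)%N%:Z.
Proof.
rewrite {}/S {}/T => pE h_gt0 K_gt0; have : (0 < K * K)%N by rewrite muln_gt0 K_gt0.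
move: (K * K)%N => M M_gt0 sum1 sum2.
have pZ : p%:Z = 2 * h%:Z + 1 by rewrite pE; lia.
have n0E : n0%:Z = p%:Z * M%:Z - 2 * h%:Z * (a%:Z + b%:Z).
  have : n0%:Z + h%:Z * (2 * a%:Z + 2 * b%:Z) = p%:Z * M%:Z by lia.
  by move=> <-; ring.
split; first by rewrite n0E pZ; ring.
have {}sum2 : n0%:Z ^+ 2 + h%:Z * ((2 * a%:Z) ^+ 2 + (2 * b%:Z) ^+ 2)
    = p%:Z * M%:Z + (p%:Z * M%:Z - 1) * M%:Z.
  have p_neq0 : p%:Z != 0 by lia.
  apply: (mulfI p_neq0).
  have -> : p%:Z * M%:Z - 1 = ((p * M).-1)%:Z by rewrite -PoszM; lia.
  move/(congr1 Posz): sum2; rewrite -!mulnn !(PoszM, PoszD) !expr2 => ->.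
  ring.
have h_neq0 : 2 * h%:Z != 0 by lia.
apply: (mulfI h_neq0); move: sum2; rewrite n0E pZ => /eqP; rewrite -subr_eq0 => /eqP sum2.
by apply/eqP; rewrite -subr_eq0 -sum2; apply/eqP; ring.
Qed.

(** Descent determines [T] only up to sign, so it stays open which of the two classes has the larger
    count. The final multiplicities are symmetric in the two. *)
Lemma value_counts (p h k n0 a b : nat) (M := (p ^ (2 * k))%N) (K := (p ^ k)%N) :
  prime p -> p = (2 * h).+1 ->
  (n0 + h * (2 * a + 2 * b) = p * M)%N ->
  (p * (n0 ^ 2 + h * ((2 * a) ^ 2 + (2 * b) ^ 2)) = p * (p * M) + (p * M).-1 * (p * M))%N ->
  n0 = M /\ (2 * a = M + K /\ 2 * b = M - K \/ 2 * a = M - K /\ 2 * b = M + K)%N.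
Proof.
move=> pr_p pE; have K_gt0 : (0 < K)%N by rewrite expn_gt0 prime_gt0.
have h_gt0 : (0 < h)%N by have := prime_gt1 pr_p; lia.
have ME : M = (K * K)%N by rewrite /M /K -expnD addnn mul2n.
rewrite ME => sum1 sum2.
have [n0E pell] := value_counts_pell p h K n0 a b pE h_gt0 K_gt0 sum1 sum2.
have MZ : (K * K)%N%:Z = p%:Z ^+ (2 * k) by rewrite -ME -[LHS]natz natrX natz.
have [S0] := pell_prime p k _ _ pr_p (etrans pell MZ).
have -> : p%:Z ^+ k = K%:Z by rewrite -[RHS]natz natrX natz.
move=> TE; split; first by apply/eqP; rewrite -eqz_nat n0E S0 mulr0 subr0.
have KM : (K <= K * K)%N by rewrite leq_pmulr.
move: (K * K)%N S0 KM {ME MZ pell n0E sum1 sum2} => {}M; clearbody K.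
by move: TE; clear; lia.
Qed.


(** * The prime subfield and equidistribution over it *)

Section PrimeSubfield.
Variables (F : finFieldType) (p : nat).
Hypotheses (pr_p : prime p) (charFp : p \in [pchar F]).

Definition prime_subfield : {set F} := [set c | c ^+ p == c].
Local Notation P := prime_subfield.

Lemma FrobeniusD i (x y : F) : (x + y) ^+ (p ^ i) = x ^+ (p ^ i) + y ^+ (p ^ i).
Proof. by apply: exprDn_pchar; rewrite pnatX (eq_pnat _ (pcharf_eq charFp)) pnat_id. Qed.

Lemma FrobeniusN i (x : F) : (- x) ^+ (p ^ i) = - x ^+ (p ^ i).
Proof.
apply/eqP; rewrite -addr_eq0 -FrobeniusD addNr expr0n expn_eq0.
by case: p pr_p.
Qed.

Lemma prime_subfieldX i c : c \in P -> c ^+ (p ^ i) = c.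
Proof.
rewrite inE => /eqP cP; elim: i => [|i IHi]; first by rewrite expr1.
by rewrite expnSr exprM IHi.
Qed.

Lemma prime_subfieldD : {in P &, forall c d, c + d \in P}.
Proof.
by move=> c d; rewrite !inE => /eqP cP /eqP dP; rewrite -[p]expn1 FrobeniusD expn1 cP dP.
Qed.

Lemma prime_subfieldN : {in P, forall c, - c \in P}.
Proof. by move=> c; rewrite !inE => /eqP cP; rewrite -[p]expn1 FrobeniusN expn1 cP. Qed.

Lemma prime_subfieldM : {in P &, forall c d, c * d \in P}.
Proof. by move=> c d; rewrite !inE exprMn => /eqP-> /eqP->. Qed.

Lemma prime_subfieldV : {in P, forall c, c^-1 \in P}.
Proof. by move=> c; rewrite !inE exprVn => /eqP->. Qed.

Lemma prime_subfield0 : 0 \in P.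
Proof. by rewrite inE expr0n; case: p pr_p. Qed.

Lemma prime_subfield1 : 1 \in P.
Proof. by rewrite inE expr1n. Qed.

Lemma prime_subfield_nat n : n%:R \in P.
Proof.
by elim: n => [|n IHn]; rewrite ?prime_subfield0 // -natr1 prime_subfieldD ?prime_subfield1.
Qed.

Lemma natr_inj_ord : injective (fun i : 'I_p => i%:R : F).
Proof.
suff le_inj (i j : 'I_p) : i%:R = j%:R :> F -> (i <= j)%N.
  by move=> i j eq_ij; apply/val_inj/eqP; rewrite eqn_leq !le_inj.
move=> eq_ij; rewrite leqNgt; apply/negP => lt_ji.
have: (p %| i - j)%N by rewrite (dvdn_pcharf charFp) natrB ?(ltnW lt_ji) // eq_ij subrr.
by move/dvdn_leq; have := ltn_ord i; lia.
Qed.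

Lemma card_prime_subfield : #|P| = p.
Proof.
have p_gt1 := prime_gt1 pr_p.
apply/eqP; rewrite eqn_leq; apply/andP; split.
  (* The roots of ['X^p - 'X] bound the size from above, the [p] distinct multiples of 1 from
     below. *)
  have szp : size ('X^p - 'X : {poly F}) = p.+1.
    by rewrite size_polyDl ?size_polyXn // size_polyN size_polyX.
  have p_neq0 : ('X^p - 'X : {poly F}) != 0 by rewrite -size_poly_eq0 szp.
  have := max_poly_roots p_neq0 _ (enum_uniq P); rewrite szp ltnS -cardE; apply.
  apply/allP=> c; rewrite mem_enum inE => /eqP cP.
  by rewrite /root !hornerE cP subrr.
rewrite -[X in (X <= _)%N](card_ord p) -(card_imset _ natr_inj_ord).
by apply/subset_leq_card/subsetP=> _ /imsetP[i _ ->]; apply: prime_subfield_nat.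
Qed.

Lemma card_prime_subfield_units : #|P :\ 0| = p.-1.
Proof. by rewrite -[in RHS]card_prime_subfield (cardsD1 0 P) prime_subfield0. Qed.

Lemma prime_subfieldP c : c \in P -> exists n, c = n%:R.
Proof.
move=> cP; suff: c \in [set (i%:R : F) | i : 'I_p] by case/imsetP=> i _ ->; exists i.
suff /eqP-> : [set (i%:R : F) | i : 'I_p] == P by [].
rewrite eqEcard card_prime_subfield card_imset ?card_ord ?leqnn ?andbT; last exact: natr_inj_ord.
by apply/subsetP=> _ /imsetP[i _ ->]; apply: prime_subfield_nat.
Qed.

(* [g] shifts the level sets of [L] along the additive group of the prime field,
   which is generated by [e]. *)
Lemma equidistribution (T : finType) (A : {set T}) (L : T -> F) (g : T -> T) (e c : F) :
  injective g -> {in A, forall x, g x \in A} -> {in A, forall x, L x \in P} ->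
  {in A, forall x, L (g x) = L x + e} -> e \in P -> e != 0 -> c \in P ->
  #|A| = (p * #|[set x in A | L x == c]|)%N.
Proof.
move=> g_inj gA LP Lg eP e_neq0 cP.
pose n d := #|[set x in A | L x == d]|.
have n_step d : (n d <= n (d + e)%R)%N.
  rewrite /n -(card_imset _ g_inj); apply/subset_leq_card/subsetP=> _ /imsetP[x xd ->].
  by move: xd; rewrite !inE => /andP[xA /eqP Lx]; rewrite gA //= Lg // Lx.
(* Inequalities along single steps suffice: steps by [e] lead from any element of the prime field to
   any other, so they hold in both directions. *)
have n_le d d' : d \in P -> d' \in P -> (n d <= n d')%N.
  move=> dP d'P.
  have [i defi] : exists i, (d' - d) / e = i%:R.
    by apply/prime_subfieldP/prime_subfieldM/prime_subfieldV=> //; apply/prime_subfieldD/prime_subfieldN.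
  have -> : d' = d + e *+ i by rewrite -mulr_natr -defi mulrCA divff // mulr1 addrC subrK.
  elim: i {defi} => [|i IHi]; first by rewrite addr0.
  by rewrite mulrSr addrA (leq_trans IHi).
rewrite (card_fibers_in _ _ A L P) // -[X in (X * _)%N]card_prime_subfield.
rewrite -sum_nat_const; apply: eq_bigr => d dP.
by apply/eqP; rewrite eqn_leq !n_le.
Qed.

End PrimeSubfield.

(** * The trace to the prime field *)

Section TraceForm.
Variables (F : finFieldType) (p m : nat).
Hypotheses (pr_p : prime p) (charFp : p \in [pchar F]).
Hypotheses (m_gt0 : (0 < m)%N) (cardF : #|F| = (p ^ m)%N).

Local Notation P := (prime_subfield F p).
Local Notation Tr := (trace F p m).

Lemma expf_cardX i (x : F) : x ^+ (p ^ (m * i)) = x.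
Proof.
elim: i => [|i IHi]; first by rewrite muln0 expr1.
by rewrite mulnS expnD exprM -cardF expf_card.
Qed.

Lemma traceD x y : Tr (x + y) = Tr x + Tr y.
Proof. by rewrite -big_split; apply: eq_bigr => i _; apply: FrobeniusD. Qed.

Lemma traceN x : Tr (- x) = - Tr x.
Proof. by rewrite /trace -sumrN; apply: eq_bigr => i _; apply: FrobeniusN. Qed.

Lemma trace0 : Tr 0 = 0.
Proof. by apply: (addrI (Tr 0)); rewrite -traceD !addr0. Qed.

Lemma traceZ c x : c \in P -> Tr (c * x) = c * Tr x.
Proof.
move=> cP; rewrite /trace mulr_sumr; apply: eq_bigr => i _.
by rewrite exprMn (prime_subfieldX _ _ _ _ cP).
Qed.

Lemma trace_Frobenius i x : Tr (x ^+ (p ^ i)) = Tr x.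
Proof.
elim: i => [|i IHi]; first by rewrite expr1.
rewrite -[RHS]IHi expnSr exprM; move: (x ^+ _) => {IHi}x.
(* The power [p] permutes the conjugates of [x] cyclically; the last one wraps around because
   [x ^+ (p ^ m) = x]. *)
rewrite /trace -(prednK m_gt0) big_ord_recr [RHS]big_ord_recl /= addrC.
congr (_ + _); last by apply: eq_bigr => j _; rewrite -exprM -expnS.
by rewrite -exprM -expnS prednK // -cardF expf_card expr1.
Qed.

Lemma trace_prime x : Tr x \in P.
Proof.
rewrite inE -[X in _ == X](trace_Frobenius 1) expn1; apply/eqP.
have -> : Tr x ^+ p = \sum_(i < m) (x ^+ (p ^ i)) ^+ p.
  rewrite -[X in _ ^+ X]expn1; apply: (big_morph (fun x : F => x ^+ (p ^ 1))).
    by move=> y z; apply: FrobeniusD.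
  by rewrite expr0n expn1; case: p pr_p.
by apply: eq_bigr => i _; rewrite -!exprM mulnC.
Qed.

(** As a polynomial the trace is nonzero, its coefficient of ['X] being 1, and has degree at most
    [p ^ m.-1]. This is less than the order of the field, so it cannot vanish everywhere. *)
Lemma trace_neq0 : exists x, Tr x != 0.
Proof.
apply/existsP; apply: contraT; rewrite negb_exists => /forallP Tr0.
have p_gt1 := prime_gt1 pr_p.
pose T : {poly F} := \sum_(i < m) 'X^(p ^ i).
have T_neq0 : T != 0.
  apply/eqP => /(congr1 (fun q : {poly F} => q`_1)); apply/eqP.
  rewrite coef0 coef_sum (bigD1 (Ordinal m_gt0)) //= big1 => [|i i_neq0].
    by rewrite coefXn addr0 oner_eq0.
  rewrite coefXn -[X in X == (_ ^ _)%N](expn0 p) eqn_exp2l //.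
  have /negPf i_neq0' : (i : nat) != 0%N by exact: i_neq0.
  by rewrite eq_sym i_neq0'.
have szT : (size T <= (p ^ m.-1).+1)%N.
  apply: (leq_trans (size_sum _ _ _)); apply/bigmax_leqP => i _.
  by rewrite size_polyXn ltnS leq_exp2l // -ltnS prednK.
have: (size (enum F) < size T)%N.
  apply: max_poly_roots T_neq0 _ (enum_uniq F).
  apply/allP=> x _; rewrite /root horner_sum.
  by under eq_bigr do rewrite hornerXn; have /negPn := Tr0 x.
move/leq_trans/(_ szT); rewrite ltnS -cardE cardF leq_exp2l //.
by rewrite leqNgt ltn_predL m_gt0.
Qed.

Lemma trace_nondegenerate a : a != 0 -> exists x, Tr (a * x) != 0.
Proof.
move=> a_neq0; have [x Tr_x] := trace_neq0.
by exists (a^-1 * x); rewrite mulVKf.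
Qed.

(** If [Tr (a * x)] were a multiple [c * Tr x] for all [x], nondegeneracy would give [a = c], an
    element of the prime field. A point where this fails is corrected by a multiple of [x0] to lie
    in the kernel of the trace. *)
Lemma trace_independent a : a \notin P -> exists2 x, Tr x = 0 & Tr (a * x) != 0.
Proof.
move=> aP; have [x0 Tr_x0] := trace_neq0.
pose c := Tr (a * x0) / Tr x0.
have cP : c \in P.
  by apply: prime_subfieldM; rewrite ?prime_subfieldV ?trace_prime.
have [|x Trx] := trace_nondegenerate (a - c).
  by apply: contraNneq aP => /eqP; rewrite subr_eq0 => /eqP->.
pose d := Tr x / Tr x0.
have dP : d \in P by apply: prime_subfieldM; rewrite ?prime_subfieldV ?trace_prime.
exists (x - d * x0); first by rewrite traceD traceN traceZ // divfK // subrr.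
apply: contraNneq Trx; rewrite mulrBr mulrBl !traceD !traceN [a * (_ * _)]mulrCA.
by rewrite (traceZ c) // (traceZ d) // => <-; rewrite /c /d; apply/eqP; ring.
Qed.

(** * The quadratic form and its polarisation *)

Variable u : nat.

Definition quad (y : F) : F := Tr (y ^+ (p ^ u + 1)).
(** The outer power inverts the power [p ^ u], since the power [p ^ (m * u)] is the identity. With
    the Frobenius invariance of the trace this frees [y] of all powers in
    [Tr (z ^+ (p ^ u) * y + z * y ^+ (p ^ u))], so that [polar] represents the polar form through
    the trace pairing. *)
Definition polar (z : F) : F := (z ^+ (p ^ (2 * u)) + z) ^+ (p ^ (m.-1 * u)).

Lemma quad_prime y : quad y \in P.
Proof. exact: trace_prime. Qed.

Lemma quad0 : quad 0 = 0.
Proof. by rewrite /quad addn1 expr0n trace0. Qed.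

Lemma quadN y : quad (- y) = quad y.
Proof. by rewrite /quad addn1 !exprSr FrobeniusN // mulrNN. Qed.

Lemma quadZ t y : t \in P -> quad (t * y) = t ^+ 2 * quad y.
Proof.
move=> tP; rewrite /quad addn1 exprMn exprSr (prime_subfieldX _ _ _ _ tP) -expr2.
by rewrite traceZ // expr2 prime_subfieldM.
Qed.

Lemma polarK z : polar z ^+ (p ^ u) = z ^+ (p ^ (2 * u)) + z.
Proof. by rewrite -exprM -expnD -[X in (_ + X)%N]mul1n -mulnDl addn1 prednK // expf_cardX. Qed.

Lemma polarB y z : polar (y - z) = polar y - polar z.
Proof.
rewrite /polar -(FrobeniusN F p) // -(FrobeniusD F p) //.
by congr (_ ^+ _); rewrite opprD FrobeniusD // FrobeniusN // addrACA.
Qed.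

Lemma quadD y z : quad (y + z) = quad y + quad z + Tr (polar z * y).
Proof.
have -> : Tr (polar z * y) = Tr (z ^+ (p ^ u) * y) + Tr (z * y ^+ (p ^ u)).
  rewrite -(trace_Frobenius u) exprMn polarK mulrDl traceD; congr (_ + _).
  by rewrite -[RHS](trace_Frobenius u) exprMn -exprM -expnD mul2n addnn.
rewrite -!traceD; congr trace.
by rewrite addn1 !exprSr FrobeniusD //; ring.
Qed.

Hypotheses (p_odd : odd p) (m_odd : odd m).

Lemma two_neq0 : 2%:R != 0 :> F.
Proof.
rewrite -(dvdn_pcharf charFp); apply/negP=> /dvdn_leq; have := prime_gt1 pr_p.
by case: p p_odd => [|[|[|]]] //= *; lia.
Qed.

Lemma oppr_fixed (x : F) : x = - x -> x = 0.
Proof.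
move/eqP; rewrite -subr_eq0 opprK -mulr2n -mulr_natr mulf_eq0 (negPf two_neq0) orbF.
exact/eqP.
Qed.

(* A zero of [polar] is negated by an automorphism of odd order [m]. *)
Lemma polar_inj : injective polar.
Proof.
move=> y z /eqP; rewrite -subr_eq0 -polarB => /eqP polar_z.
apply/eqP; rewrite -subr_eq0; move: (y - z) polar_z => {y z} z polar_z.
have sgn_z i : z ^+ (p ^ (2 * u * i)) = (-1) ^+ i * z.
  elim: i => [|i IHi]; first by rewrite muln0 expr1 mul1r.
  have := polarK z; rewrite polar_z expr0n expn_eq0 -[p == 0%N]negbK -lt0n prime_gt0 //=.
  move/esym/eqP; rewrite addr_eq0 => /eqP Fz.
  by rewrite mulnS expnD exprM Fz FrobeniusN // IHi exprS mulN1r mulNr.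
apply/eqP/oppr_fixed; rewrite -{1}(expf_cardX (2 * u) z) mulnC sgn_z.
by rewrite -signr_odd m_odd mulN1r.
Qed.

Lemma polar0 : polar 0 = 0.
Proof. by have := polarB 0 0; rewrite !subrr. Qed.

(** * Value distribution of the quadratic form *)

Definition quad_count (c : F) : nat := #|[set y | quad y == c]|.

Lemma card_trace_fiber (a c : F) : a != 0 -> c \in P ->
  #|F| = (p * #|[set x | Tr (a * x)%R == c]|)%N.
Proof.
move=> /trace_nondegenerate[x0 Tr_x0] cP; rewrite -cardsT.
rewrite (equidistribution F p pr_p charFp _ [set: F] (fun x => Tr (a * x)) (+%R x0) _ c _ _ _ _ _ Tr_x0) //.
- by congr (_ * #|pred_of_set _|)%N; apply/setP=> x; rewrite !inE.
- exact: addrI.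
- by move=> x _; apply: trace_prime.
- by move=> x _; rewrite mulrDr traceD addrC.
exact: trace_prime.
Qed.

Lemma sum_quad_count : (\sum_(c in P) quad_count c)%N = #|F|.
Proof.
rewrite -cardsT (card_fibers_in _ _ [set: F] quad P) => [|x _]; last exact: quad_prime.
by apply: eq_bigr => c _; apply: eq_card => y; rewrite !inE.
Qed.

(* Substituting [(w + v, w - v)] turns the equation [quad y = quad z] into the
   bilinear one [Tr (polar v * w) = 0]. *)
Lemma sum_quad_count_sqr :
  (p * \sum_(c in P) quad_count c ^ 2 = p * #|F| + #|F|.-1 * #|F|)%N.
Proof.
pose S := [set yz : F * F | quad yz.1 == quad yz.2].
have -> : (\sum_(c in P) quad_count c ^ 2)%N = #|S|.
  rewrite (card_fibers_in _ _ S (fun yz => quad yz.1) P) => [|yz _]; last exact: quad_prime.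
  apply: eq_bigr => c _; rewrite expnS expn1 /quad_count -cardsX; apply: eq_card => -[y z].
  by rewrite !inE /=; case: (quad y =P c) => [->|]; rewrite ?andbF // andbT eq_sym.
pose h (vw : F * F) := (vw.2 + vw.1, vw.2 - vw.1).
have h_inj : injective h.
  move=> [v w] [v' w'] [/= eqD eqB].
  have w0 : w = w'.
    apply: (mulfI two_neq0); transitivity ((w + v) + (w - v)); first by ring.
    by rewrite eqD eqB; ring.
  by move: eqD; rewrite w0 => /addrI->.
rewrite -(card_preimset _ h_inj).
rewrite (card_fibers _ _ (h @^-1: S) (fun vw => vw.1)) big_distrr /= (bigD1 0) //=.
have fib v : #|[set vw in h @^-1: S | vw.1 == v]| = #|[set w | Tr (polar v * w) == 0]|.
  have pair_inj : injective (pair v : F -> F * F) by move=> w w' [].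
  rewrite -(card_imset _ pair_inj); apply: eq_card => -[v' w]; rewrite !inE /=.
  have -> : (quad (w + v') == quad (w - v')) = (Tr (polar v' * w) == 0).
    rewrite !quadD quadN -(sub0r v') polarB.
    rewrite polar0 sub0r mulNr traceN (inj_eq (addrI _)).
    by apply/eqP/eqP => [/oppr_fixed | ->]; rewrite ?oppr0.
  apply/andP/imsetP => [[Tr0 /eqP eqv] | [w' ]]; first by exists w; rewrite ?inE -?eqv.
  by rewrite inE => Tr0 [-> ->].
(* The fibre over [v = 0] is the whole field; each other fibre is a hyperplane, because
   [polar v <> 0] by injectivity. *)
congr (_ + _)%N.
  by rewrite fib; congr (_ * _)%N; apply: eq_card => w; rewrite inE polar0 mul0r trace0 eqxx.
rewrite -[in RHS](cardC1 0) -sum_nat_const; apply: eq_bigr => v v_neq0.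
rewrite fib -card_trace_fiber ?prime_subfield0 //.
by rewrite -polar0 (inj_eq polar_inj).
Qed.

Lemma quad_countZ (t c : F) : t \in P -> t != 0 -> quad_count (t ^+ 2 * c) = quad_count c.
Proof.
have le_count s d : s \in P -> s != 0 -> (quad_count d <= quad_count (s ^+ 2 * d)%R)%N.
  move=> sP s_neq0; rewrite /quad_count -(card_imset _ (mulfI s_neq0)).
  apply/subset_leq_card/subsetP=> _ /imsetP[y yd ->]; move: yd; rewrite !inE => /eqP<-.
  by rewrite quadZ.
move=> tP t_neq0; apply/eqP; rewrite eqn_leq le_count // andbT.
have := le_count t^-1 (t ^+ 2 * c); rewrite mulrA -exprMn mulVf // expr1n mul1r; apply.
  exact: prime_subfieldV.
by rewrite invr_eq0.
Qed.

(** The free involution [y -> - y] pairs the solutions. Passing to half counts matters for the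
    descent: for [p = 3] the undivided equation [p S^2 + T^2 = 4 p^(2k)] has further solutions such
    as [S = T = 3^k]. *)
Lemma even_quad_count (c : F) : c != 0 -> exists n, quad_count c = (2 * n)%N.
Proof.
move=> c_neq0; exists #|[set y ^+ 2 | y in [set y | quad y == c]]|.
apply: card_sqr_symmetric; first exact: two_neq0.
  by rewrite inE quad0 eq_sym.
by move=> y; rewrite !inE quadN.
Qed.

(** The count is constant on the nonzero squares and on their coset [g * Sq], each of size
    [p.-1./2]. The function [f] is left free so that one statement yields both moments, the list of
    possible counts and the sizes of the level sets. *)
Lemma sum_quad_classes : exists a b : F,
  [/\ a != 0, b != 0 &
  forall f : nat -> nat, (\sum_(c in P) f (quad_count c) =
    f (quad_count 0%R) + p.-1./2 * (f (quad_count a) + f (quad_count b)))%N].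
Proof.
pose Pu := P :\ 0; pose Sq := [set t ^+ 2 | t in Pu].
have card_Pu : #|Pu| = p.-1 by apply: card_prime_subfield_units.
have card_Sq : #|Sq| = p.-1./2.
  rewrite -card_Pu (card_sqr_symmetric _ Pu) ?mul2n ?doubleK ?two_neq0 ?setD11 // => y.
  by rewrite !inE oppr_eq0 => /andP[-> yP]; have := prime_subfieldN F p pr_p charFp y; rewrite !inE; apply.
have p1E : p.-1 = (2 * p.-1./2)%N.
  by rewrite -[LHS]odd_double_half mul2n; case: p pr_p p_odd => //= n _ /negPf->.
have h_gt0 : (0 < p.-1./2)%N by have := prime_gt1 pr_p; lia.
have Sq_sub : Sq \subset Pu.
  apply/subsetP=> _ /imsetP[t /setD1P[t_neq0 tP] ->].
  by rewrite in_setD1 expf_neq0 // expr2 prime_subfieldM.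
have card_NSq : #|Pu :\: Sq| = p.-1./2.
  by rewrite cardsD (setIidPr Sq_sub) card_Sq card_Pu; lia.
have /card_gt0P[g] : (0 < #|Pu :\: Sq|)%N by rewrite card_NSq.
rewrite in_setD => /andP[gSq /setD1P[g_neq0 gP]].
have NSqE : Pu :\: Sq = [set g * s | s in Sq].
  apply/esym/eqP; rewrite eqEcard card_NSq card_imset ?card_Sq ?leqnn ?andbT; last exact: mulfI.
  apply/subsetP=> _ /imsetP[_ /imsetP[t /setD1P[t_neq0 tP] ->] ->].
  rewrite in_setD in_setD1 mulf_neq0 ?expf_neq0 //= expr2 !prime_subfieldM // andbT.
  apply: contra gSq => /imsetP[s /setD1P[s_neq0 sP] defs].
  apply/imsetP; exists (s / t).
    by rewrite in_setD1 mulf_neq0 ?invr_eq0 //= prime_subfieldM // prime_subfieldV.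
  by rewrite exprMn -defs exprVn -expr2 mulfK // expf_neq0.
exists 1, g; split; rewrite ?oner_eq0 // => f.
rewrite (big_setD1 0) /= ?prime_subfield0 //; congr (_ + _)%N.
rewrite (big_setID Sq) /= (setIidPr Sq_sub) mulnDr; congr (_ + _)%N.
  rewrite -card_Sq -sum_nat_const; apply: eq_bigr => _ /imsetP[t /setD1P[t_neq0 tP] ->].
  by rewrite -[t ^+ 2]mulr1 quad_countZ.
rewrite -card_NSq -sum_nat_const; apply: eq_bigr => s; rewrite NSqE.
move=> /imsetP[_ /imsetP[t /setD1P[t_neq0 tP] ->] ->].
by rewrite mulrC quad_countZ.
Qed.

(** Level sets are measured in points [z] rather than in values, since [z] will parametrise [b]. A
    class of [p.-1./2] values taken [v] times each contributes [p.-1./2 * v] points. *)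
Lemma quad_distribution (k := m.-1./2) :
  [/\ forall z, [\/ quad_count (quad z) = p ^ (2 * k), quad_count (quad z) = p ^ (2 * k) + p ^ k
                  | quad_count (quad z) = p ^ (2 * k) - p ^ k],
      #|[set z | quad_count (quad z) == p ^ (2 * k) + p ^ k]| = p.-1./2 * (p ^ (2 * k) + p ^ k)
    & #|[set z | quad_count (quad z) == p ^ (2 * k) - p ^ k]| = p.-1./2 * (p ^ (2 * k) - p ^ k)]%N.
Proof.
have [a [b [a_neq0 b_neq0 sumE]]] := sum_quad_classes.
have [a' aE] := even_quad_count a a_neq0; have [b' bE] := even_quad_count b b_neq0.
set h := p.-1./2 in sumE *.
have pE : p = (2 * h).+1.
  rewrite /h mul2n; have := odd_double_half p.-1.
  by case: p pr_p p_odd => //= n _ /negPf->; rewrite add0n => ->.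
have mE : m = (2 * k).+1.
  rewrite /k mul2n; have := odd_double_half m.-1.
  by case: m m_gt0 m_odd => //= n _ /negPf->; rewrite add0n => ->.
have qE : #|F| = (p * p ^ (2 * k))%N by rewrite cardF mE expnS.
have := sum_quad_count; rewrite (sumE id) /= => sum1.
have := sum_quad_count_sqr; rewrite (sumE (fun n => n ^ 2)%N) => sum2.
move: sum1 sum2; rewrite aE bE qE; set n0 := quad_count 0.
have K_gt0 : (0 < p ^ k)%N by rewrite expn_gt0 prime_gt0.
have KM : (p ^ k <= p ^ (2 * k))%N by rewrite leq_pexp2l ?prime_gt0 // leq_pmull.
move=> sum1 /(value_counts _ _ _ _ _ _ pr_p pE sum1)[n0M vals].
move: (p ^ (2 * k))%N (p ^ k)%N K_gt0 KM n0M vals => M K K_gt0 KM n0M vals {sum1 qE}.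
have card_level v : #|[set z | quad_count (quad z) == v]| =
    (\sum_(c in P) (if quad_count c == v then quad_count c else 0))%N.
  rewrite (card_fibers_in _ _ _ quad P) => [|z _]; last exact: quad_prime.
  apply: eq_bigr => c _; case: eqP => [cv|ncv].
    by apply: eq_card => z; rewrite !inE andbC; apply: andb_idr => /eqP->; apply/eqP.
  apply: eq_card0 => z; rewrite !inE; apply/negP=> /andP[/eqP zv /eqP zc].
  by rewrite zc in zv.
split.
(* This [f] marks the counts outside the list. Its sum over the prime field vanishes, hence so does
   every term. *)
- move=> z; pose f n : nat := ~~ [|| n == M, n == M + K | n == M - K]%N.
  have := sumE f; rewrite aE bE -/n0 n0M.
  have -> : (f M = 0)%N by rewrite /f eqxx.
  have -> : (f (2 * a') = 0)%N by case: vals => -[-> _]; rewrite /f eqxx !orbT.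
  have -> : (f (2 * b') = 0)%N by case: vals => -[_ ->]; rewrite /f eqxx !orbT.
  rewrite muln0 => /eqP; rewrite sum_nat_eq0 => /forall_inP/(_ _ (quad_prime z)).
  rewrite /f eqb0 negbK => /or3P[] /eqP; [by constructor 1 | by constructor 2 | by constructor 3].
- rewrite card_level (sumE (fun n => if n == _ then n else _)) aE bE -/n0 n0M.
  rewrite ifN ?add0n; last by lia.
  by case: vals => -[-> ->]; rewrite eqxx ifN ?addn0 //; lia.
rewrite card_level (sumE (fun n => if n == _ then n else _)) aE bE -/n0 n0M.
rewrite ifN ?add0n; last by lia.
by case: vals => -[-> ->]; rewrite eqxx ifN ?addn0 //; lia.
Qed.

(** * Zero coordinates on the hypersurface with the origin restored *)

Definition trace_locus : {set F * F} :=
  [set z : F * F | Tr (z.1 + z.2 ^+ (p ^ u + 1)) == 0].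
Local Notation E := trace_locus.

Definition zero_coords (a b : F) : {set F * F} :=
  [set z in E | Tr (a * z.1 + b * z.2) == 0].

Lemma addl_pair_inj (v : F * F) : injective (fun z : F * F => (v.1 + z.1, v.2 + z.2)).
Proof. by move=> [x y] [x' y'] [/addrI-> /addrI->]. Qed.

Lemma card_trace_locus : (#|F| * #|F| = p * #|E|)%N.
Proof.
have [x0 Tr_x0] := trace_neq0.
rewrite -card_prod -cardsT.
rewrite (equidistribution F p pr_p charFp _ [set: F * F] (fun z => Tr (z.1 + z.2 ^+ (p ^ u + 1)))
  (fun z => (x0 + z.1, 0 + z.2)) _ 0 _ _ _ _ _ Tr_x0) //.
- by congr (_ * #|pred_of_set _|)%N; apply/setP=> z; rewrite !inE.
- exact: addl_pair_inj (x0, 0).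
- by move=> z _; apply: trace_prime.
- by move=> z _; rewrite /= add0r -addrA (traceD x0) [RHS]addrC.
- exact: trace_prime.
exact: prime_subfield0.
Qed.

Lemma card_zero_coords_generic (a b : F) :
  a \notin P \/ a = 0 /\ b != 0 -> #|E| = (p * #|zero_coords a b|)%N.
Proof.
case=> [/trace_independent[x0 Tr_x0 Tr_ax0] | [-> /trace_nondegenerate[y0 Tr_y0]]].
  (* Translating [x] by an element of trace zero preserves the hypersurface and changes the
     coordinate by the nonzero constant [Tr (a * x0)]. *)
  apply: (equidistribution F p pr_p charFp _ E _ (fun z => (x0 + z.1, 0 + z.2)) _ 0 _ _ _ _ _ Tr_ax0).
  - exact: addl_pair_inj (x0, 0).
  - by move=> z; rewrite !inE /= add0r -addrA (traceD x0) Tr_x0 add0r.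
  - by move=> z _; apply: trace_prime.
  - by move=> z _; rewrite /= add0r mulrDr -addrA (traceD (a * x0)) [RHS]addrC.
  - exact: trace_prime.
  exact: prime_subfield0.
(* The translation in [y] is corrected in [x] so as to stay on the locus. *)
pose g (z : F * F) := (z.1 + z.2 ^+ (p ^ u + 1) - (y0 + z.2) ^+ (p ^ u + 1), y0 + z.2).
apply: (equidistribution F p pr_p charFp _ E _ g _ 0 _ _ _ _ _ Tr_y0).
- by move=> [x y] [x' y'] [/= eqx /addrI eqy]; move: eqx; rewrite eqy => /addIr/addIr->.
- by move=> z; rewrite !inE /= subrK.
- by move=> z _; apply: trace_prime.
- by move=> z _; rewrite /= !mul0r !add0r mulrDr (traceD (b * y0)) [RHS]addrC.
- exact: trace_prime.
exact: prime_subfield0.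
Qed.

Lemma trace_polar_diag z : Tr (polar z * z) = 2%:R * quad z.
Proof.
have := quadD z (- z); rewrite subrr quad0 quadN -(sub0r z) polarB polar0 sub0r mulNr traceN.
by move/eqP; rewrite eq_sym subr_eq0 => /eqP<-; rewrite mulr_natl mulr2n.
Qed.

(* Completing the square. *)
Lemma card_quad_eq_linear z :
  #|[set y | quad y == Tr (polar z * y)]| = quad_count (quad z).
Proof.
rewrite -(card_imset _ (addIr (- z))); apply: eq_card => y; rewrite inE.
have quad_shift w : (quad w == Tr (polar z * w)) = (quad (w - z) == quad z).
  have -> : quad w = quad (w - z) - quad z + Tr (polar z * w).
    rewrite -[in LHS](subrK z w) (quadD (w - z)) mulrBr (traceD (polar z * w)) traceN trace_polar_diag.
    ring.
  by rewrite -subr_eq0 addrK subr_eq0.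
apply/imsetP/idP => [[w] | yz]; first by rewrite inE quad_shift => ? ->.
by exists (y + z); rewrite ?addrK // inE quad_shift addrK.
Qed.

(** On the hypersurface [Tr x = - quad y], so for [a] in the prime field the coordinate is
    [a * (Tr (polar z * y) - quad y)], and its vanishing is a condition on [y] alone. For each such
    [y], a fraction [1 / p] of all [x] satisfies the trace equation. *)
Lemma card_zero_coords_special (a z : F) : a \in P -> a != 0 ->
  (p * #|zero_coords a (a * polar z)%R| = #|F| * quad_count (quad z))%N.
Proof.
move=> aP a_neq0; have [x0 Tr_x0] := trace_neq0.
pose A : {set F * F} := setX [set: F] [set y | quad y == Tr (polar z * y)].
rewrite -card_quad_eq_linear -cardsT -cardsX -/A.
rewrite (equidistribution F p pr_p charFp _ A (fun z => Tr (z.1 + z.2 ^+ (p ^ u + 1)))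
  (fun z => (x0 + z.1, 0 + z.2)) _ 0 _ _ _ _ _ Tr_x0) //.
- congr (_ * #|pred_of_set _|)%N; apply/setP=> -[x y]; rewrite !inE /= andbC; apply: andb_id2r.
  rewrite traceD addr_eq0 => /eqP Tr_x; rewrite -mulrA -mulrDr traceZ // traceD Tr_x.
  by rewrite mulf_eq0 (negPf a_neq0) /= addrC subr_eq0 eq_sym.
- exact: addl_pair_inj (x0, 0).
- by move=> w; rewrite !inE /= add0r.
- by move=> w _; apply: trace_prime.
- by move=> w _; rewrite /= add0r -addrA (traceD x0) [RHS]addrC.
- exact: trace_prime.
exact: prime_subfield0.
Qed.

(** * Weights of the codewords *)

Lemma tnth_codeword a b i : tnth (codeword F p m u a b) i =
  Tr (a * (enum_val i).1 + b * (enum_val i).2).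
Proof. exact: tnth_mktuple. Qed.

(** Restoring the origin does not affect the weight, as every coordinate function vanishes there. *)
Lemma wt_codeword a b : (wt (codeword F p m u a b) + #|zero_coords a b| = #|E|)%N.
Proof.
rewrite -(cardsID (zero_coords a b) E) addnC; congr (_ + _)%N.
  by congr #|pred_of_set _|; apply/setP=> z; rewrite !inE andbA andbb.
rewrite /wt /codeword count_map -sum1_count big_enum_cond /= big_mkcond /=.
rewrite -(big_enum_val (fun z => if Tr (a * z.1 + b * z.2) != 0 then 1%N else 0%N)).
rewrite -big_mkcondr sum1dep_card; apply: eq_card => z; rewrite !inE.
case: (trace _ _ _ (z.1 + _) == 0); rewrite ?andbF //= !andbT.
by apply: andb_idl; apply: contraNneq => ->; rewrite !mulr0 addr0 trace0.
Qed.

Lemma card_D1 : #|D1 F p m u| = #|E|.-1.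
Proof.
have E0 : (0, 0) \in E by rewrite inE /= addn1 expr0n addr0 trace0.
rewrite (cardsD1 (0, 0) E) E0 add1n; apply: eq_card => z.
by rewrite !inE.
Qed.


Local Notation k := m.-1./2.
Local Notation M := (p ^ (2 * k))%N.
Local Notation cw ab := (codeword F p m u ab.1 ab.2).

Lemma m_eq : m = (2 * k).+1.
Proof.
rewrite mul2n; have := odd_double_half m.-1.
by case: m m_gt0 m_odd => //= n _ /negPf->; rewrite add0n => ->.
Qed.

Lemma cardFE : #|F| = (p * M)%N.
Proof. by rewrite cardF {1}m_eq expnS. Qed.

Lemma card_trace_locusE : #|E| = (p * M * M)%N.
Proof.
apply/eqP; rewrite -(eqn_pmul2l (prime_gt0 pr_p)) -card_trace_locus cardFE.
by apply/eqP; lia.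
Qed.

Lemma wt_special a z : a \in P -> a != 0 ->
  (wt (codeword F p m u a (a * polar z)%R) + M * quad_count (quad z) = p * M * M)%N.
Proof.
move=> aP a_neq0; rewrite -card_trace_locusE -(wt_codeword a (a * polar z)); congr (_ + _)%N.
apply/eqP; rewrite -(eqn_pmul2l (prime_gt0 pr_p)) card_zero_coords_special // cardFE.
by rewrite mulnA.
Qed.

Lemma wt_generic a b : a \notin P \/ a = 0 /\ b != 0 ->
  (wt (codeword F p m u a b) + M * M = p * M * M)%N.
Proof.
move=> ab; rewrite -card_trace_locusE -(wt_codeword a b); congr (_ + _)%N.
apply/eqP; rewrite -(eqn_pmul2l (prime_gt0 pr_p)) -card_zero_coords_generic // card_trace_locusE.
by rewrite mulnA.
Qed.

Lemma wt0 : wt (codeword F p m u 0 0) = 0%N.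
Proof.
apply/eqP; rewrite -(eqn_add2r #|zero_coords 0 0|) wt_codeword add0n; apply/eqP.
by apply: eq_card => z; rewrite !inE !mul0r addr0 trace0 eqxx andbT.
Qed.

Lemma polar_surj b : exists z, b = polar z.
Proof.
have /codomP[z ->] : b \in codom polar by rewrite (inj_card_onto polar_inj).
by exists z.
Qed.

Lemma codeword_cases a b :
  [\/ (a, b) = (0, 0), a \notin P \/ a = 0 /\ b != 0
    | [/\ a \in P, a != 0 & exists z, b = a * polar z]].
Proof.
have [aP | aP] := boolP (a \in P); last by constructor 2; left.
have [-> | a_neq0] := eqVneq a 0.
  have [-> | b_neq0] := eqVneq b 0; first by constructor 1.
  by constructor 2; right.
constructor 3; split=> //; have [z defz] := polar_surj (a^-1 * b).
by exists z; rewrite -defz mulVKf.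
Qed.

(** The condition [v <> M] excludes the generic weight and [v < p * M] the zero codeword. The
    remaining pairs are parametrised bijectively by [(a, z) -> (a, a * polar z)]. *)
Lemma card_weight v : v <> M -> (v < p * M)%N ->
  #|[set ab | wt (cw ab) + M * v == p * M * M]%N| =
  (p.-1 * #|[set z | quad_count (quad z) == v]|)%N.
Proof.
move=> v_neq v_lt; have M_gt0 : (0 < M)%N by rewrite expn_gt0 prime_gt0.
rewrite -(card_prime_subfield_units F p pr_p charFp) -cardsX.
pose f (az : F * F) := (az.1, az.1 * polar az.2).
have f_inj : {in setX (P :\ 0) [set z | quad_count (quad z) == v] &, injective f}.
  move=> [a z] [a' z']; rewrite !inE /= => /andP[/andP[a_neq0 _] _] _ [<- /(mulfI a_neq0)].
  by move/polar_inj->.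
rewrite -(card_in_imset f_inj); apply: eq_card => -[a b]; rewrite inE /=.
apply/eqP/imsetP => [wv | [[a' z]]]; last first.
  rewrite in_setX /= in_setD1 => /andP[/andP[a_neq0 aP]]; rewrite inE => /eqP zv [-> ->].
  by rewrite -(wt_special a' z) // zv.
case: (codeword_cases a b) => [[a0 b0]|/wt_generic|[aP a_neq0 [z defb]]].
- move: wv; rewrite a0 b0 wt0 mulnC; move: v_lt; nia.
- move=> wM; case: v_neq; apply/eqP.
  by rewrite -(eqn_pmul2l M_gt0) -(eqn_add2l (wt (codeword F p m u a b))) wM wv.
exists (a, z); rewrite /f /= -?defb // in_setX in_setD1 /= a_neq0 aP inE /=.
have := wt_special a z aP a_neq0; rewrite -defb -wv => /addnI/eqP.
by rewrite eqn_pmul2l.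
Qed.

Lemma quad_count_lt z : (quad_count (quad z) < p * M)%N.
Proof.
have M_gt0 : (0 < M)%N by rewrite expn_gt0 prime_gt0.
have KM : (p ^ k <= M)%N by rewrite leq_pexp2l ?prime_gt0 // leq_pmull.
have p_gt2 : (2 < p)%N by rewrite odd_prime_gt2.
by case: quad_distribution => /(_ z)[] -> _ _; nia.
Qed.

(** The key to dimension [2m]: together with linearity it makes [(a, b)] recoverable from its
    codeword. In the special case [quad_count_lt] keeps the weight positive. *)
Lemma wt_eq0 a b : wt (codeword F p m u a b) = 0%N -> (a, b) = (0, 0).
Proof.
have M_gt0 : (0 < M)%N by rewrite expn_gt0 prime_gt0.
have p_gt1 := prime_gt1 pr_p.
case: (codeword_cases a b) => [//|/wt_generic wtE wt_ab|[aP a_neq0 [z ->]] wt_ab].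
  by exfalso; move: wtE; rewrite wt_ab; nia.
by exfalso; have := wt_special a z aP a_neq0; rewrite wt_ab; have := quad_count_lt z; nia.
Qed.

Lemma codewordB_coord a b a' b' i : tnth (codeword F p m u (a - a') (b - b')) i =
  tnth (codeword F p m u a b) i - tnth (codeword F p m u a' b') i.
Proof.
rewrite !tnth_codeword -traceN -traceD; congr trace; ring.
Qed.

Lemma codeword_inj : injective (fun ab : F * F => cw ab).
Proof.
move=> [a b] [a' b'] /= eq_cw.
have [] : (a - a', b - b') = (0, 0).
  apply: wt_eq0; apply/eqP; rewrite -leqn0 leqNgt -has_count; apply/hasPn => x /tnthP[i ->].
  by rewrite codewordB_coord eq_cw subrr eqxx.
by move=> /subr0_eq-> /subr0_eq->.
Qed.

Lemma card_code_pred (Pr : pred (#|D1 F p m u|.-tuple F)) :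
  #|[set c in code F p m u | Pr c]| = #|[set ab | Pr (cw ab)]|.
Proof.
rewrite -(card_imset _ codeword_inj); apply: eq_card => c; rewrite inE.
apply/andP/imsetP => [[/imsetP[ab _ ->] Prc]|[ab]].
  by exists ab; rewrite ?inE.
by rewrite inE => Prab ->; split=> //; apply/imsetP; exists ab.
Qed.

Lemma wt_cases ab : let K := (p ^ k)%N in
  [\/ wt (cw ab) = 0, wt (cw ab) + M * M = p * M * M,
      wt (cw ab) + M * (M + K) = p * M * M
    | wt (cw ab) + M * (M - K) = p * M * M]%N.
Proof.
case: ab => a b /=.
case: (codeword_cases a b) => [[-> ->]|/wt_generic|[aP a_neq0 [z ->]]].
- by constructor 1; apply: wt0.
- by constructor 2.
have := wt_special a z aP a_neq0.
by case: quad_distribution => /(_ z)[] -> _ _;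
  [constructor 2 | constructor 3 | constructor 4].
Qed.

End TraceForm.

(** * Rational weights and assembly of the distribution *)

Lemma one_of_four_weights (w x y z : nat) : (0 < y)%N -> (y <= x)%N -> (2 * x < z)%N ->
  [\/ w = 0, w + x = z, w + (x + y) = z | w + (x - y) = z]%N ->
  ((w == 0) + (w + x == z) + (w + (x + y) == z) + (w + (x - y) == z) = 1)%N.
Proof. by move=> y_gt0 le_yx lt_xz [] wE; do 4![case: eqP => ?]; lia. Qed.

(** Transfers weight comparisons from the rationals to an equation in natural numbers without
    subtraction, the form in which the weights were computed. *)
Lemma eq_rat_weight (w v M p : nat) (W : rat) :
  W = p%:Q * M%:Q * M%:Q - M%:Q * v%:Q ->
  (w%:Q == W) = (w + M * v == p * M * M)%N.
Proof.
by move=> ->; rewrite eq_sym subr_eq eq_sym -!rmorphM -rmorphD eqr_int.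
Qed.

Theorem theorem1 (F : finFieldType) (p m u : nat)
  (hp : prime p) (hodd : odd p) (hchar : p \in [pchar F])
  (hm : (0 < m)%N) (hq : #|F| = (p ^ m)%N) (hu : (0 < u)%N)
  (hmodd : odd m) :
  let C := code F p m u in
  let k := ((m - 1) %/ 2)%N in
  let W1 : rat := (p%:Q - 1) * p%:Q ^+ (2 * m - 2) in
  let W2 : rat := (p%:Q - 1) * p%:Q ^+ (2 * m - 2)
                  * (1 - 1 / ((p%:Q - 1) * p%:Q ^+ k)) in
  let W3 : rat := (p%:Q - 1) * p%:Q ^+ (2 * m - 2)
                  * (1 + 1 / ((p%:Q - 1) * p%:Q ^+ k)) in
  [/\
    (* length *)
    #|D1 F p m u| = (p ^ (2 * m - 1) - 1)%N,
    (* an F_p-linear code: entries in the prime field F_p, closed under + *)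
    (forall c, c \in C -> forall i, (tnth c i) ^+ p = tnth c i),
    (forall c d, c \in C -> d \in C ->
        [tuple tnth c i + tnth d i | i < #|D1 F p m u|] \in C),
    (* dimension 2m *)
    #|C| = (p ^ (2 * m))%N &
    [/\
    (* every codeword has one of the listed weights *)
    (forall c, c \in C ->
        [\/ wt c = 0%N, (wt c)%:Q = W1, (wt c)%:Q = W2 | (wt c)%:Q = W3]) &
    (* weight distribution *)
    [/\ #|[set c in C | wt c == 0%N]| = 1%N,
        #|[set c in C | (wt c)%:Q == W1]|%:Q
          = p%:Q ^+ (2 * m) - 1 - (p%:Q - 1) ^+ 2 * p%:Q ^+ (m - 1),
        #|[set c in C | (wt c)%:Q == W2]|%:Q
          = 1 / 2 * (p%:Q - 1) ^+ 2 * (p%:Q ^+ (m - 1) + p%:Q ^+ k) &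
        #|[set c in C | (wt c)%:Q == W3]|%:Q
          = 1 / 2 * (p%:Q - 1) ^+ 2 * (p%:Q ^+ (m - 1) - p%:Q ^+ k)]]].
Proof.
have p_gt1 := prime_gt1 hp; have p_gt2 : (2 < p)%N by rewrite odd_prime_gt2.
have mE : m = (2 * m.-1./2).+1 by apply: m_eq.
move=> C k; have -> : k = m.-1./2 by rewrite /k divn2 subn1.
clear k; set k := m.-1./2 in mE *; set M := (p ^ (2 * k))%N; set K := (p ^ k)%N.
have ME : (M = K * K)%N by rewrite /M /K -expnD addnn mul2n.
have K_gt0 : (0 < K)%N by rewrite expn_gt0 prime_gt0.
have M_gt0 : (0 < M)%N by rewrite ME muln_gt0 K_gt0.
have KM : (K <= M)%N by rewrite ME leq_pmulr.
have pX n : p%:Q ^+ n = (p ^ n)%N%:Q by rewrite -[LHS](rmorphXn (intr : int -> rat)) -natz -natrX natz.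
have pm2 : (p ^ (2 * m - 2) = M * M)%N.
  by rewrite /M -expnD; congr (_ ^ _)%N; lia.
have pm1 : (p ^ (m - 1) = M)%N by rewrite /M; congr (_ ^ _)%N; lia.
have neq2 : (M + K <> M)%N by lia.
have lt2 : (M + K < p * M)%N by nia.
have neq3 : (M - K <> M)%N by lia.
have lt3 : (M - K < p * M)%N by lia.
have n_eq : (2 * m - 1 = (2 * m - 2).+1)%N by lia.
have MQ : M%:Q = K%:Q * K%:Q by rewrite ME PoszM rmorphM.
have MKQ : (M - K)%N%:Q = M%:Q - K%:Q by rewrite -[RHS]intrB subzn.
have K_neq0 : K%:Q != 0 by rewrite intr_eq0; lia.
have p1_neq0 : p%:Q - 1 != 0 by rewrite subr_eq0 -[1]/(1%:Q) eqr_int; lia.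
rewrite !pX pm2 pm1 -/K => W1 W2 W3.
have W1E := fun w => eq_rat_weight w M M p W1.
have W2E := fun w => eq_rat_weight w (M + K) M p W2.
have W3E := fun w => eq_rat_weight w (M - K) M p W3.
have {}W1E (w : nat) : (w%:Q == W1) = (w + M * M == p * M * M)%N.
  by apply: W1E; rewrite /W1 PoszM intrM /=; ring.
(* Since [M = K * K], the correction [M * M / K] equals [M * K], whence
   [W2 = p * M * M - M * (M + K)]; likewise for [W3]. *)
have {}W2E (w : nat) : (w%:Q == W2) = (w + M * (M + K) == p * M * M)%N.
  apply: W2E; rewrite /W2 PoszM PoszD intrM intrD /= MQ; field.
  by rewrite K_neq0 p1_neq0.
have {}W3E (w : nat) : (w%:Q == W3) = (w + M * (M - K) == p * M * M)%N.
  apply: W3E; rewrite /W3 MKQ PoszM intrM /= MQ; field.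
  by rewrite K_neq0 p1_neq0.
have wt_casesC := wt_cases F p m hp hchar hm hq u hodd hmodd.
have card_wt := card_weight F p m hp hchar hm hq u hodd hmodd.
have cardC := card_code_pred F p m hp hchar hm hq u hodd hmodd.
have [_ level2 level3] := quad_distribution F p m hp hchar hm hq u hodd hmodd.
rewrite -/k -/M -/K in wt_casesC card_wt level2 level3.
have cardFF : #|{: F * F}| = (p ^ (2 * m))%N by rewrite card_prod hq -expnD addnn mul2n.
have h2 : (2 * p.-1./2 = p.-1)%N.
  rewrite mul2n -[RHS]odd_double_half; case: (p) hp hodd => //= n _ /negPf->.
  by rewrite add0n.
have p1Q : p.-1%:Q = p%:Q - 1 by rewrite -[RHS](intrB _ p 1) subzn ?subn1 // ltnW.
have hQ : p.-1./2%:Q = (p%:Q - 1) / 2 by rewrite -p1Q -[in RHS]h2 PoszM intrM mulrC mulKf.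
have card0 : #|[set c in C | wt c == 0%N]| = 1%N.
  rewrite cardC -(cards1 ((0, 0) : F * F)); apply: eq_card => -[a b]; rewrite !inE /=.
  apply/eqP/eqP => [|[-> ->]]; last by apply: wt0.
  by apply: (wt_eq0 F p m hp hchar hm hq u hodd hmodd).
have card2 : #|[set c in C | (wt c)%:Q == W2]| = (p.-1 * (p.-1./2 * (M + K)))%N.
  rewrite cardC -level2 -card_wt //.
  by apply: eq_card => ab; rewrite !inE W2E.
have card3 : #|[set c in C | (wt c)%:Q == W3]| = (p.-1 * (p.-1./2 * (M - K)))%N.
  rewrite cardC -level3 -card_wt //.
  by apply: eq_card => ab; rewrite !inE W3E.
(* The four weights are distinct and exhaust all pairs, so the multiplicity of [W1] follows by
   subtracting the other three. *)
have card_total : (#|[set c in C | wt c == 0%N]| + #|[set c in C | (wt c)%:Q == W1]| +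
    #|[set c in C | (wt c)%:Q == W2]| + #|[set c in C | (wt c)%:Q == W3]| = p ^ (2 * m))%N.
  have card_sum (Pr : pred (F * F)) : #|[set ab | Pr ab]| = (\sum_ab Pr ab)%N.
    by rewrite -sum1dep_card big_mkcond; apply: eq_bigr => ab _; case: (Pr ab).
  rewrite !cardC !card_sum -cardFF -[RHS]sum1_card -!big_split /=.
  apply: eq_bigr => ab _; rewrite W1E W2E W3E.
  have := wt_casesC ab; move: (wt _) => w /=.
  have : (0 < M * K)%N by rewrite muln_gt0 M_gt0.
  have : (M * K <= M * M)%N by rewrite leq_mul2l KM orbT.
  have : (2 * (M * M) < p * M * M)%N by rewrite -[(p * M * M)%N]mulnA ltn_pmul2r ?muln_gt0 ?M_gt0.
  by rewrite mulnDr mulnBr => zx yx y0; apply: one_of_four_weights.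
split.
- rewrite card_D1 // (card_trace_locusE F p m hp hchar hm hq u hodd hmodd) -/k -/M.
  by rewrite -mulnA -pm2 -expnS subn1 n_eq.
- move=> _ /imsetP[ab _ ->] i; rewrite tnth_codeword.
  by have := trace_prime F p m hp hchar hm hq (ab.1 * (enum_val i).1 + ab.2 * (enum_val i).2); rewrite inE => /eqP.
- move=> _ _ /imsetP[[a b] _ ->] /imsetP[[a' b'] _ ->].
  apply/imsetP; exists (a + a', b + b') => //; apply: eq_from_tnth => i.
  rewrite tnth_mktuple !tnth_codeword -traceD //; congr trace => /=; ring.
- rewrite /C /code card_imset ?cardsT //.
  exact: (codeword_inj F p m hp hchar hm hq u hodd hmodd).
split.
  move=> _ /imsetP[ab _ ->]; have := wt_casesC ab; case=> /eqP.
  - by move=> /eqP; constructor 1.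
  - by rewrite -W1E => /eqP; constructor 2.
  - by rewrite -W2E => /eqP; constructor 3.
  by rewrite -W3E => /eqP; constructor 4.
have card2Q : #|[set c in C | (wt c)%:Q == W2]|%:Q = 1 / 2 * (p%:Q - 1) ^+ 2 * (M%:Q + K%:Q).
  by rewrite card2 !PoszM PoszD !intrM intrD /= p1Q hQ; field.
have card3Q : #|[set c in C | (wt c)%:Q == W3]|%:Q = 1 / 2 * (p%:Q - 1) ^+ 2 * (M%:Q - K%:Q).
  by rewrite card3 !PoszM !intrM /= MKQ p1Q hQ; field.
split=> //.
by rewrite -card_total card0 !PoszD !intrD /= card2Q card3Q; field.
Qed.
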